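(* Let $(v_n)_n$ be a strictly increasing infinite sequence of positive integers, and let $\mathcal{S}=\{v_n:n\in\mathbb{N}\}$. Suppose that one of the following conditions holds: (a) $\psi\in\mathcal{D}_1$; (b) $\psi\in\mathcal{D}_2$ and $\psi'(v_n)/\psi(n)\to0$ as $n\to\infty$. Then $$\underline{\operatorname{d}}_{\psi}(\mathcal{S})=\liminf_{n\to\infty}\frac{\mathcal{S}_{\psi}(v_n)}{\psi(v_n)}\quad\text{and}\quad\overline{\operatorname{d}}_{\psi}(\mathcal{S})=\limsup_{n\to\infty}\frac{\mathcal{S}_{\psi}(v_n)}{\psi(v_n)}.$$
   Context: $\mathbb{N}=\{1,2,3,\dots\}$ and $\chi_A$ is the characteristic function of a set $A\subset\mathbb{N}$. $\mathcal{D}$ denotes the class of strictly increasing, differentiable, unbounded functions $\psi:(0,\infty)\to(0,\infty)$. $\mathcal{D}_1$ is the class of all concave functions in $\mathcal{D}$. $\mathcal{D}_2$ is the class of all convex functions $\psi\in\mathcal{D}$ that satisfy $\psi(n+1)/\psi(n)\to1$ as $n\to\infty$ through the positive integers. For $\psi\in\mathcal{D}$ and $A\subset\mathbb{N}$, set $A_\psi(n)=\sum_{k=1}^n\psi'(k)\chi_A(k)$; in particular $\mathcal{S}_\psi(n)=\sum_{k=1}^n\psi'(k)\chi_{\mathcal{S}}(k)$. The lower and upper $\psi$-densities of $A$ are $$\underline{\operatorname{d}}_\psi(A)=\liminf_{n\to\infty}\frac{A_\psi(n)}{\sum_{k=1}^n\psi'(k)},\qquad\overline{\operatorname{d}}_\psi(A)=\limsup_{n\to\infty}\frac{A_\psi(n)}{\sum_{k=1}^n\psi'(k)}.$$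 *)

(* Defs.v *)
From mathcomp Require Import all_boot all_order all_algebra.
From mathcomp Require Import all_classical all_reals all_analysis.
Import Order.TTheory GRing.Theory Num.Theory.
Import numFieldNormedType.Exports.
Set Implicit Arguments.
Unset Strict Implicit.
Unset Printing Implicit Defensive.
Local Open Scope classical_set_scope.
Local Open Scope ring_scope.

(* A function (0, oo) -> (0, oo) is represented by a total function R -> R whose
   values outside (0, oo) are irrelevant. Since (0, oo) is open, the two-sided
   derivative at a point of (0, oo) only depends on psi there. *)
Definition classD (R : realType) (psi : R -> R) : Prop :=
  [/\ forall x, 0 < x -> 0 < psi x,
      forall x y, 0 < x -> x < y -> psi x < psi y,
      forall x, 0 < x -> derivable psi x 1 &
      ~ [bounded psi x | x in [set x : R | 0 < x]] ].

Definition classD1 (R : realType) (psi : R -> R) : Prop :=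
  classD psi /\
  convex_function [set x : R^o | 0 < x] (fun x : R^o => - psi x).

Definition classD2 (R : realType) (psi : R -> R) : Prop :=
  [/\ classD psi,
      convex_function [set x : R^o | 0 < x] psi &
      psi n.+1%:R / psi n%:R @[n --> \oo] --> (1 : R)].

Section densities.
Variables (R : realType) (psi : R -> R) (A : set nat).

Definition weighted_count (n : nat) : R :=
  \sum_(1 <= k < n.+1) derive1 psi k%:R * \1_A k.

Definition total_weight (n : nat) : R :=
  \sum_(1 <= k < n.+1) derive1 psi k%:R.

(* The term n = 0, where the denominator is an empty sum, does not affect the
   lower and upper limits. *)
Definition lower_density : \bar R :=
  limn_einf (fun n => (weighted_count n / total_weight n)%:E).

Definition upper_density : \bar R :=
  limn_esup (fun n => (weighted_count n / total_weight n)%:E).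

End densities.

(* Main.v *)
Require Import Defs.
From mathcomp Require Import all_boot all_order all_algebra.
From mathcomp Require Import all_classical all_reals all_analysis.
From mathcomp Require Import zify ring lra.
Import Order.TTheory GRing.Theory Num.Theory.
Import numFieldNormedType.Exports.
Local Open Scope classical_set_scope.
Local Open Scope ring_scope.
Set Implicit Arguments.
Unset Strict Implicit.
Unset Printing Implicit Defensive.

(** Write w k for the derivative of psi at the integer k, T n for the sum of
    w 1, ..., w n and W n for the part of that sum carried by S.

    Two asymptotic facts about the weights drive everything: T n / psi n tends
    to 1 and w n / psi n tends to 0 (the predicate [regular_weight]). A concave
    or convex graph lies on one side of its tangents, so each w k is squeezed
    between two consecutive increments of psi, and the sums of increments
    telescope: T n lies between psi n and psi (n + 1) up to additive constants.
    In the concave case the constants vanish against psi n, which is unbounded,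
    and w n <= w 1; in the convex case psi (n + 1) / psi n tends to 1, and this
    also absorbs w n <= psi (n + 1) - psi n.

    Given these facts, W / T may be replaced by W / psi along any sequence
    tending to infinity, since W / psi - W / T = (W / T) (T / psi - 1) and
    0 <= W / T <= 1. It remains to see that both limits of W / T over all
    integers are already reached along the v n. For v n <= m < v (n + 1) the
    numerator W m is constant while T grows, so W m / T m is at most its value
    at v n, which settles the upper limit. For the lower limit, put
    p = v (n + 1); then W m = W p - w p and T m <= T p, whence
    W m / T m >= W p / T p - w p / T p, and the last term tends to 0. *)

(** * Comparing upper and lower limits of two sequences *)

(** The terms of u and x need not be matched index by index: it is enough that
    each late term of u is nearly dominated by some late term of x. This is what
    allows a sequence to be compared with one of its subsequences. *)
Lemma le_limn_esup_approx (R : realType) (u x : nat -> R) :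
  (forall e K, 0 < e -> \forall m \near \oo,
     exists2 n, (K <= n)%N & u m <= x n + e) ->
  (limn_esup (fun n => (u n)%:E) <= limn_esup (fun n => (x n)%:E))%E.
Proof.
move=> ux; apply: le_ereal_inf_tmp => _ [V [K _ KV] <-].
apply/lee_addgt0Pr => e e_gt0; apply: ge_ereal_inf.
exists (ereal_sup [set (u m)%:E | m in
    [set m | exists2 n, (K <= n)%N & u m <= x n + e]]).
  by eexists; [exact: (ux e K e_gt0)|].
apply: ge_ereal_sup => _ [m [n Kn umx] <-].
apply: (@le_trans _ _ ((x n)%:E + e%:E)%E); first by rewrite -EFinD lee_fin.
by apply: leeD => //; apply: ereal_sup_ubound; exists n => //; exact: KV.
Qed.

Lemma le_limn_einf_approx (R : realType) (u x : nat -> R) :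
  (forall e K, 0 < e -> \forall m \near \oo,
     exists2 n, (K <= n)%N & x n - e <= u m) ->
  (limn_einf (fun n => (x n)%:E) <= limn_einf (fun n => (u n)%:E))%E.
Proof.
move=> ux; rewrite /limn_einf leeN2.
apply: (@le_limn_esup_approx _ (fun n => - u n) (fun n => - x n)) => e K e_gt0.
apply: filterS (ux e K e_gt0) => m [n Kn xu]; exists n => //; lra.
Qed.

(** * The weights given by a concave or convex function *)

(** The quotient (f (x + h (y - x)) - f x) / h is at most f y - f x for
    0 < h <= 1, by convexity; its limit at 0 is the derivative in the direction
    y - x. *)
Lemma tangent_le_convex (R : realType) (f : R -> R) (x y : R) :
  convex_function [set z : R^o | 0 < z] f -> derivable f x 1 ->
  0 < x -> 0 < y -> derive1 f x * (y - x) <= f y - f x.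
Proof.
move=> cf df x_gt0 y_gt0.
have dfx : differentiable f x by exact/derivable1_diffP.
have -> : derive1 f x * (y - x) = 'D_(y - x) f x.
  rewrite derive1E !deriveE// mulrC.
  by rewrite -[LHS]/((y - x) *: 'd f x 1) -linearZ /= [_ *: _]mulr1.
have /cvg_dnbhs_at_right cvD := @diff_derivable _ _ _ _ _ (y - x) dfx.
rewrite /derive -(cvg_lim _ cvD)//.
apply: limr_le; first by apply/cvg_ex; eexists; exact: cvD.
near=> h.
have h_gt0 : 0 < h by [].
have h_le1 : h <= 1 by apply/ltW; near: h; exact: nbhs_right_lt.
have := cf (Itv01 (ltW h_gt0) h_le1) y x.
rewrite !inE /= => /(_ y_gt0 x_gt0).
rewrite !convRE /= /unstable.onem => cxy.
rewrite -[leLHS]/(h^-1 * (f (h * (y - x) + x) - f x)) mulrC ler_pdivrMr//.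
have -> : h * (y - x) + x = h * y + (1 - h) * x by ring.
lra.
Unshelve. all: by end_near. Qed.

Lemma le_sum_increments (R : realType) (f w : nat -> R) (n : nat) :
  (forall k, (1 <= k)%N -> f k.+1 - f k <= w k) -> (1 <= n)%N ->
  f n - f 1%N <= \sum_(1 <= k < n) w k.
Proof.
move=> fw n_ge1; rewrite -telescope_sumr//.
by apply: ler_sum_nat => k /andP[k_ge1 _]; exact: fw.
Qed.

Lemma ge_sum_increments (R : realType) (f w : nat -> R) (n : nat) :
  (forall k, (1 <= k)%N -> w k <= f k.+1 - f k) -> (1 <= n)%N ->
  \sum_(1 <= k < n) w k <= f n - f 1%N.
Proof.
move=> wf n_ge1; rewrite -telescope_sumr//.
by apply: ler_sum_nat => k /andP[k_ge1 _]; exact: wf.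
Qed.

Lemma total_weight_recl (R : realType) (psi : R -> R) (n : nat) :
  total_weight psi n.+1 =
  derive1 psi 1 + \sum_(1 <= k < n.+1) derive1 psi k.+1%:R.
Proof. by rewrite /total_weight big_ltn// big_add1. Qed.

(** Monotonicity bounds psi near 0, so unboundedness forces psi to tend to
    infinity. *)
Lemma classD_cvg_invr (R : realType) (psi : R -> R) :
  classD psi -> (psi n%:R)^-1 @[n --> \oo] --> (0 : R).
Proof.
move=> [psi_gt0 psi_incr _ psi_unb].
apply/gtr0_cvgV0.
  by exists 1%N => // n /= n_ge1; apply: psi_gt0; rewrite ltr0n.
apply/cvgryPge => A.
have [x x_gt0 Ax] : exists2 x, 0 < x & A <= psi x.
  apply: contrapT => noA; apply: psi_unb.
  exists A; split; first exact: num_real.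
  move=> M AM x /= x_gt0; apply: le_trans (ltW AM).
  rewrite ger0_norm ?(ltW (psi_gt0 _ _))// leNgt; apply/negP => Ax.
  by apply: noA; exists x => //; exact: ltW.
near=> n; apply: (le_trans Ax); apply/ltW/psi_incr => //.
by near: n; exact: nbhs_infty_gtr.
Unshelve. all: by end_near. Qed.

Lemma cvg_affine0 (R : realType) (c b : R) (u : nat -> R) :
  u n @[n --> \oo] --> (0 : R) -> c + b * u n @[n --> \oo] --> c.
Proof.
move=> u0; rewrite -[X in _ --> X]addr0 -[X in _ + X](mulr0 b).
by apply: cvgD; [exact: cvg_cst|exact: cvgMl_tmp].
Qed.

(** The only properties of psi on which the comparison of densities depends. *)
Definition regular_weight (R : realType) (psi : R -> R) : Prop :=
  [/\ forall k, (1 <= k)%N -> 0 < derive1 psi k%:R,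
      total_weight psi n / psi n%:R @[n --> \oo] --> (1 : R) &
      derive1 psi n%:R / psi n%:R @[n --> \oo] --> (0 : R)].

(** The tangents at 1 and at n, each evaluated at the other point, show that the
    derivative at n is at most the derivative at 1; divided by psi n, it
    vanishes. *)
Lemma regular_weight_concave (R : realType) (psi : R -> R) :
  classD1 psi -> regular_weight psi.
Proof.
move=> [psiD cpsi]; have psiV := classD_cvg_invr psiD.
case: psiD => psi_gt0 psi_incr psi_der _.
have tangent x y : 0 < x -> 0 < y -> psi y - psi x <= derive1 psi x * (y - x).
  move=> x_gt0 y_gt0.
  have := tangent_le_convex cpsi (derivableN (psi_der _ x_gt0)) x_gt0 y_gt0.
  rewrite derive1E (@deriveN _ _ _ psi)//; last exact: psi_der.
  rewrite -derive1E; lra.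
have nat_gt0 k : (1 <= k)%N -> 0 < k%:R :> R by rewrite ltr0n.
have succB k : k.+1%:R - k%:R = 1 :> R by rewrite -natr1 addrAC subrr add0r.
have lo k : (1 <= k)%N -> psi k.+1%:R - psi k%:R <= derive1 psi k%:R.
  move=> k_ge1; have := tangent _ _ (nat_gt0 _ k_ge1) (ltr0Sn R k).
  by rewrite succB mulr1.
have hi k : (1 <= k)%N -> derive1 psi k.+1%:R <= psi k.+1%:R - psi k%:R.
  move=> k_ge1; have := tangent _ _ (ltr0Sn R k) (nat_gt0 _ k_ge1).
  by rewrite -[k%:R - _]opprB succB; lra.
have d_gt0 k : (1 <= k)%N -> 0 < derive1 psi k%:R.
  move=> k_ge1; apply: lt_le_trans (lo _ k_ge1).
  by rewrite subr_gt0 psi_incr ?nat_gt0// ltr_nat.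
split=> //.
- apply: (@squeeze_cvgr _ _ _ _ (fun n => 1 + (- psi 1) * (psi n%:R)^-1)
    (fun n => 1 + (derive1 psi 1 - psi 1) * (psi n%:R)^-1)); last 2 first.
  + exact: cvg_affine0.
  + exact: cvg_affine0.
  exists 1%N => // -[//|n] _.
  have p_gt0 := psi_gt0 _ (ltr0Sn R n).
  rewrite ler_pdivlMr// ler_pdivrMr// !mulrDl -!mulrA mulVf ?gt_eqF// !mulr1 mul1r.
  have T_ge := le_sum_increments (f := fun k => psi k%:R) lo (ltn0Sn n.+1).
  have lt_psi : psi n.+1%:R < psi n.+2%:R by rewrite psi_incr// ltr_nat.
  have := ge_sum_increments (f := fun k => psi k%:R) hi (ltn0Sn n).
  have := total_weight_recl psi n.
  rewrite /total_weight /= in T_ge *; lra.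
- apply: (@squeeze_cvgr _ _ _ _ (fun=> 0)
    (fun n => 0 + derive1 psi 1 * (psi n%:R)^-1)); last 2 first.
  + exact: cvg_cst.
  + exact: cvg_affine0.
  exists 1%N => // n /= n_ge1.
  have p_gt0 := psi_gt0 _ (nat_gt0 _ n_ge1).
  rewrite add0r divr_ge0 ?(ltW p_gt0) ?(ltW (d_gt0 _ n_ge1))//=.
  rewrite ler_pM2r ?invr_gt0//.
  have [->//|n_gt1] := eqVneq n 1%N.
  have n1 : 0 < n%:R - 1 :> R by rewrite subr_gt0 ltr1n ltn_neqAle eq_sym n_gt1.
  rewrite -(ler_pM2r n1).
  have := tangent _ _ (nat_gt0 _ n_ge1) ltr01.
  have := tangent _ _ ltr01 (nat_gt0 _ n_ge1); lra.
Qed.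

(** Here the increments bound the total weight by psi (n + 1) rather than by
    psi n, so the ratio of consecutive values of psi has to tend to 1. *)
Lemma regular_weight_convex (R : realType) (psi : R -> R) :
  classD2 psi -> regular_weight psi.
Proof.
move=> [psiD cpsi ratio1]; have psiV := classD_cvg_invr psiD.
case: psiD => psi_gt0 psi_incr psi_der _.
have tangent x y : 0 < x -> 0 < y -> derive1 psi x * (y - x) <= psi y - psi x.
  by move=> x_gt0 y_gt0; apply: tangent_le_convex => //; exact: psi_der.
have nat_gt0 k : (1 <= k)%N -> 0 < k%:R :> R by rewrite ltr0n.
have succB k : k.+1%:R - k%:R = 1 :> R by rewrite -natr1 addrAC subrr add0r.
have hi k : (1 <= k)%N -> derive1 psi k%:R <= psi k.+1%:R - psi k%:R.
  move=> k_ge1; have := tangent _ _ (nat_gt0 _ k_ge1) (ltr0Sn R k).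
  by rewrite succB mulr1.
have lo k : (1 <= k)%N -> psi k.+1%:R - psi k%:R <= derive1 psi k.+1%:R.
  move=> k_ge1; have := tangent _ _ (ltr0Sn R k) (nat_gt0 _ k_ge1).
  by rewrite -[k%:R - _]opprB succB; lra.
have d_gt0 k : (1 <= k)%N -> 0 < derive1 psi k%:R.
  (* For k = 1 the increment to the left would leave the domain, hence k / 2. *)
  move=> /nat_gt0 k_gt0; have k2_gt0 : 0 < k%:R / 2 :> R by rewrite divr_gt0.
  have lt_half : psi (k%:R / 2) < psi k%:R by apply: psi_incr => //; lra.
  rewrite -(pmulr_lgt0 _ k2_gt0).
  have := tangent _ _ k_gt0 k2_gt0; lra.
split=> //.
- apply: (@squeeze_cvgr _ _ _ _
    (fun n => 1 + (derive1 psi 1 - psi 1) * (psi n%:R)^-1)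
    (fun n => psi n.+1%:R / psi n%:R)); last 2 first.
  + exact: cvg_affine0.
  + exact: ratio1.
  exists 1%N => // -[//|n] _.
  have p_gt0 := psi_gt0 _ (ltr0Sn R n).
  rewrite ler_pdivlMr// mulrDl -mulrA mulVf ?gt_eqF// mulr1 mul1r.
  rewrite ler_pM2r ?invr_gt0//.
  have T_le := ge_sum_increments (f := fun k => psi k%:R) hi (ltn0Sn n.+1).
  have := le_sum_increments (f := fun k => psi k%:R) lo (ltn0Sn n).
  have := total_weight_recl psi n.
  have := psi_gt0 _ ltr01.
  rewrite /total_weight /= in T_le *; lra.
- apply: (@squeeze_cvgr _ _ _ _ (fun=> 0)
    (fun n => psi n.+1%:R / psi n%:R - 1)); last 2 first.
  + exact: cvg_cst.
  + by rewrite -[X in _ --> X](subrr 1); apply: cvgB; [|exact: cvg_cst].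
  exists 1%N => // n /= n_ge1.
  have p_gt0 := psi_gt0 _ (nat_gt0 _ n_ge1).
  rewrite divr_ge0 ?(ltW p_gt0) ?(ltW (d_gt0 _ n_ge1))//=.
  rewrite -[X in _ - X](divff (lt0r_neq0 p_gt0)).
  by rewrite -mulrBl ler_pM2r ?invr_gt0 ?hi.
Qed.

(** * Counting functions of a set with regular weights *)

Section weighted_count_theory.
Variables (R : realType) (psi : R -> R) (A : set nat).
Hypothesis psi_reg : regular_weight psi.

Let d_ge0 k : (1 <= k)%N -> 0 <= derive1 psi k%:R.
Proof. by case: psi_reg => d_gt0 _ _ /d_gt0/ltW. Qed.

Lemma weighted_countS n : weighted_count psi A n.+1 =
  weighted_count psi A n + derive1 psi n.+1%:R * \1_A n.+1.
Proof. by rewrite /weighted_count big_nat_recr. Qed.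

Lemma weighted_count_ge0 n : 0 <= weighted_count psi A n.
Proof.
rewrite /weighted_count big_nat_cond; apply: sumr_ge0 => k /andP[/andP[k1 _] _].
by rewrite mulr_ge0// ?d_ge0.
Qed.

Lemma le_weighted_count_total n : weighted_count psi A n <= total_weight psi n.
Proof.
apply: ler_sum_nat => k /andP[k1 _].
by rewrite ler_piMr ?d_ge0// indicE lern1 leq_b1.
Qed.

Lemma le_total_weight m n : (m <= n)%N ->
  total_weight psi m <= total_weight psi n.
Proof.
move=> mn; rewrite /total_weight (@big_cat_nat _ _ _ m.+1 1 n.+1)//= lerDl.
rewrite big_nat_cond; apply: sumr_ge0 => k /andP[/andP[k1 _] _].
by rewrite d_ge0// (leq_trans _ k1).
Qed.

Lemma total_weight_gt0 n : (1 <= n)%N -> 0 < total_weight psi n.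
Proof.
move=> n1; apply: (lt_le_trans _ (le_total_weight n1)).
by rewrite /total_weight big_nat1; case: psi_reg => /(_ 1%N) ->.
Qed.

Lemma weighted_count_gap m n : (m <= n)%N ->
  (forall k, (m < k <= n)%N -> ~ A k) ->
  weighted_count psi A n = weighted_count psi A m.
Proof.
elim: n => [|n IH]; first by rewrite leqn0 => /eqP ->.
rewrite leq_eqVlt => /orP[/eqP -> //|mn gap].
rewrite weighted_countS IH//; last first.
  by move=> k /andP[mk kn]; apply: gap; rewrite mk ltnW.
rewrite indicE memNset ?mulr0 ?addr0//.
by apply: gap; rewrite leqnn andbT.
Qed.

(** A single element of the set changes its density by a vanishing amount. *)
Lemma cvg_weight_total :
  derive1 psi n%:R / total_weight psi n @[n --> \oo] --> (0 : R).
Proof.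
case: psi_reg => d_gt0 T1 d0.
have : (derive1 psi n%:R / psi n%:R) * (total_weight psi n / psi n%:R)^-1
    @[n --> \oo] --> (0 / 1 : R).
  by apply: cvgM => //; apply: cvgV => //; exact: oner_neq0.
rewrite mul0r; apply: cvg_trans; apply: near_eq_cvg.
near=> n.
have ratio_gt0 : 0 < total_weight psi n / psi n%:R.
  by near: n; apply: cvgr_gt T1 _ _; exact: ltr01.
have psi_neq0 : psi n%:R != 0.
  by apply: contraTneq ratio_gt0 => ->; rewrite invr0 mulr0 ltxx.
have T_neq0 : total_weight psi n != 0.
  by apply: contraTneq ratio_gt0 => ->; rewrite mul0r ltxx.
by field; rewrite T_neq0.
Unshelve. all: by end_near. Qed.

(** The difference is W / T, which lies in [0, 1], times T / psi - 1. *)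
Lemma cvg_count_ratio_diff :
  weighted_count psi A n / psi n%:R - weighted_count psi A n / total_weight psi n
    @[n --> \oo] --> (0 : R).
Proof.
case: psi_reg => _ T1 _; apply/cvgr0Pnorm_le => e e_gt0.
near=> n.
have T_gt0 : 0 < total_weight psi n.
  by apply: total_weight_gt0; near: n; exact: nbhs_infty_ge.
have -> : weighted_count psi A n / psi n%:R -
    weighted_count psi A n / total_weight psi n =
    (weighted_count psi A n / total_weight psi n) *
    (total_weight psi n / psi n%:R - 1).
  by rewrite mulrBr mulr1 mulrA divfK// gt_eqF.
rewrite normrM; apply: (@le_trans _ _ `|total_weight psi n / psi n%:R - 1|).
  rewrite ler_piMl// ger0_norm ?divr_ge0 ?weighted_count_ge0 ?(ltW T_gt0)//.
  by rewrite ler_pdivrMr// mul1r le_weighted_count_total.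
by rewrite distrC; near: n; exact: cvgr_dist_le.
Unshelve. all: by end_near. Qed.

End weighted_count_theory.

(** * Positions of the integers relative to an increasing sequence *)

Lemma leq_increasing_seq (v : nat -> nat) :
  (forall n, (1 <= n)%N -> (1 <= v n)%N) ->
  (forall m n, (1 <= m)%N -> (m < n)%N -> (v m < v n)%N) ->
  forall n, (n <= v n)%N.
Proof.
move=> v_gt0 v_incr; elim=> [//|[|n] IH]; first exact: v_gt0.
exact: leq_ltn_trans IH (v_incr _ _ _ _).
Qed.

(** The lower bound K on the index lets m tend to infinity together with the
    index of its bracket. *)
Lemma increasing_seq_bracket (v : nat -> nat) :
  (forall n, (1 <= n)%N -> (1 <= v n)%N) ->
  (forall m n, (1 <= m)%N -> (m < n)%N -> (v m < v n)%N) ->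
  forall K m, (1 <= K)%N -> (v K <= m)%N ->
  exists2 n, (K <= n)%N & (v n <= m < v n.+1)%N.
Proof.
move=> v_gt0 v_incr K m K1 vKm.
have exP : exists n, (m < v n.+1)%N.
  by exists m; exact: (leq_increasing_seq v_gt0 v_incr).
case: (ex_minnP exP) => n mvn n_min; exists n.
  rewrite leqNgt; apply/negP => nK.
  suff : (v n.+1 <= v K)%N by rewrite leqNgt (leq_ltn_trans vKm).
  by move: nK; rewrite leq_eqVlt => /orP[/eqP -> //|nK]; exact/ltnW/v_incr.
rewrite mvn andbT; case: n mvn n_min => [|n] mvn n_min.
  have [K_le1|K_gt1] := leqP K 1.
    by move: vKm mvn; rewrite (_ : K = 1%N); [|lia]; lia.
  by have := v_incr 1%N K isT K_gt1; lia.
by rewrite leqNgt; apply/negP => /n_min; rewrite ltnn.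
Qed.

Lemma increasing_seq_gap (v : nat -> nat) :
  (forall m n, (1 <= m)%N -> (m < n)%N -> (v m < v n)%N) ->
  forall n k, (1 <= n)%N -> (v n < k < v n.+1)%N ->
  ~ [set v n | n in [set n | (1 <= n)%N]] k.
Proof.
move=> v_incr n k n1 /andP[nk kn] [j /= j1 jk]; move: nk kn; rewrite -jk.
have [jn|nj|->] := ltngtP j n; last by rewrite ltnn.
  by have := v_incr _ _ j1 jn; lia.
have [nj1|nj1|->] := ltngtP j n.+1; last by rewrite ltnn.
  by lia.
by have := v_incr _ _ (ltn0Sn n) nj1; lia.
Qed.

(** * Densities of the range of an increasing sequence *)

Theorem theorem3p1 (R : realType) (psi : R -> R) (v : nat -> nat)
    (v_gt0 : forall n, (1 <= n)%N -> (1 <= v n)%N)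
    (v_incr : forall m n, (1 <= m)%N -> (m < n)%N -> (v m < v n)%N)
    (psiP : classD1 psi \/
            classD2 psi /\ derive1 psi (v n)%:R / psi n%:R @[n --> \oo] --> (0 : R)) :
  let S : set nat := [set v n | n in [set n | (1 <= n)%N]] in
  lower_density psi S =
    limn_einf (fun n => (weighted_count psi S (v n) / psi (v n)%:R)%:E) /\
  upper_density psi S =
    limn_esup (fun n => (weighted_count psi S (v n) / psi (v n)%:R)%:E).
Proof.
move=> S.
have psi_reg : regular_weight psi.
  by case: psiP => [/regular_weight_concave|[/regular_weight_convex]].
pose u n := weighted_count psi S n / total_weight psi n.
pose x n := weighted_count psi S (v n) / psi (v n)%:R.
have le_v := leq_increasing_seq v_gt0 v_incr.
have near_v (P : nat -> Prop) : (\forall m \near \oo, P m) ->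
    exists2 N, (1 <= N)%N & forall n, (N <= n)%N -> P (v n).
  move=> [N _ NP]; exists N.+1 => // n Nn; apply: NP => /=.
  exact: leq_trans (ltnW Nn) (le_v n).
have T_gt0 := total_weight_gt0 psi_reg.
have W_ge0 := weighted_count_ge0 S psi_reg.
have ux e : 0 < e -> exists2 N, (1 <= N)%N &
    forall n, (N <= n)%N -> `|x n - u (v n)| <= e.
  move=> e_gt0.
  apply: (near_v (fun m => `|weighted_count psi S m / psi m%:R - u m| <= e)).
  by move/cvgr0Pnorm_le: (cvg_count_ratio_diff S psi_reg); exact.
have jump e : 0 < e -> exists2 N, (1 <= N)%N & forall n, (N <= n)%N ->
    derive1 psi (v n)%:R / total_weight psi (v n) <= e.
  move=> e_gt0.
  apply: (near_v (fun m => derive1 psi m%:R / total_weight psi m <= e)).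
  move/cvgr0Pnorm_le: (cvg_weight_total psi_reg) => /(_ e e_gt0).
  by apply: filterS => m; exact/le_trans/ler_norm.
have gap n m : (1 <= n)%N -> (v n <= m < v n.+1)%N ->
    weighted_count psi S m = weighted_count psi S (v n).
  move=> n1 /andP[nm mn]; apply: weighted_count_gap => // k /andP[nk km].
  by apply: (increasing_seq_gap v_incr n1); rewrite nk (leq_ltn_trans km).
split; apply/eqP; rewrite eq_le; apply/andP; split.
- apply: (@le_limn_einf_approx _ x u) => e K e_gt0.
  have [N N1 uxN] := ux e e_gt0.
  near=> n; exists (v n).
    by apply: leq_trans (le_v n); near: n; exact: nbhs_infty_ge.
  have /uxN : (N <= n)%N by near: n; exact: nbhs_infty_ge.
  rewrite ler_norml; lra.
- apply: (@le_limn_einf_approx _ u x) => e K e_gt0.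
  have e2_gt0 : 0 < e / 2 by rewrite divr_gt0.
  have [N N1 uxN] := ux _ e2_gt0; have [M M1 jumpM] := jump _ e2_gt0.
  pose L := maxn K (maxn N M).
  have L1 : (1 <= L)%N by lia.
  near=> m.
  have vLm : (v L <= m)%N by near: m; exact: nbhs_infty_ge.
  have [n Ln nm] := increasing_seq_bracket v_gt0 v_incr L1 vLm.
  exists n.+1; first by lia.
  have : `|x n.+1 - u (v n.+1)| <= e / 2 by apply: uxN; lia.
  have : derive1 psi (v n.+1)%:R / total_weight psi (v n.+1) <= e / 2.
    by apply: jumpM; lia.
  (* The only element of S above m and up to v n.+1 is v n.+1 itself. *)
  have Wm : weighted_count psi S m =
      weighted_count psi S (v n.+1) - derive1 psi (v n.+1)%:R.
    have vn1 : (0 < v n.+1)%N by exact: v_gt0.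
    rewrite -(prednK vn1) weighted_countS (gap n (v n.+1).-1) ?(gap n m)//; try lia.
    rewrite prednK// indicE mem_set ?mulr1 ?addrK//.
    by exists n.+1.
  have u_ge :
      u (v n.+1) - derive1 psi (v n.+1)%:R / total_weight psi (v n.+1) <= u m.
    rewrite /u -mulrBl -Wm ler_wpM2l// lef_pV2 ?posrE ?T_gt0 ?v_gt0//; last first.
      by have := le_v n; have := v_gt0 n; lia.
    by apply: le_total_weight psi_reg _ _ _; lia.
  rewrite ler_norml; lra.
- apply: (@le_limn_esup_approx _ u x) => e K e_gt0.
  have [N N1 uxN] := ux e e_gt0.
  pose L := maxn K N.
  have L1 : (1 <= L)%N by lia.
  near=> m.
  have vLm : (v L <= m)%N by near: m; exact: nbhs_infty_ge.
  have [n Ln nm] := increasing_seq_bracket v_gt0 v_incr L1 vLm.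
  exists n; first by lia.
  have : `|x n - u (v n)| <= e by apply: uxN; lia.
  have n1 : (1 <= n)%N by lia.
  have u_le : u m <= u (v n).
    rewrite /u (gap n)// ler_wpM2l// lef_pV2 ?posrE ?T_gt0 ?v_gt0//; last first.
      by have := v_gt0 n n1; lia.
    by apply: le_total_weight psi_reg _ _ _; lia.
  rewrite ler_norml; lra.
- apply: (@le_limn_esup_approx _ x u) => e K e_gt0.
  have [N N1 uxN] := ux e e_gt0.
  near=> n; exists (v n).
    by apply: leq_trans (le_v n); near: n; exact: nbhs_infty_ge.
  have /uxN : (N <= n)%N by near: n; exact: nbhs_infty_ge.
  rewrite ler_norml; lra.
Unshelve. all: by end_near. Qed.
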